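(* Let $n\ge3$ and $p,q\ge0$ with $p+q=n$. Let $\mathcal{A}^{\mathbb{C}}$ and $\mathcal{A}^{\mathbb{R}}$ be the unital complex and real algebras with generators $u_1,\ldots,u_n$ and defining relations described in the context. If the generators anticommute ($u_i\cdot u_j=-u_j\cdot u_i$ for all $i\ne j$), then $\mathcal{A}^{\mathbb{C}}\cong\mathbb{O}_n$ and $\mathcal{A}^{\mathbb{R}}\cong\mathbb{O}_{p,q}$. If the generators commute ($u_i\cdot u_j=u_j\cdot u_i$ for all $i\ne j$), then $\mathcal{A}^{\mathbb{C}}\cong\mathbb{M}_n$ and $\mathcal{A}^{\mathbb{R}}\cong\mathbb{M}_{p,q}$.
   Context: Presentation. Let $X_n$ be the set of all non-associative monomials in the symbols $u_1,\ldots,u_n$, and let $\phi:X_n\times X_n\times X_n\to\mathbb{Z}_2$ be the unique function such that (1) $\phi(u_i,u_j,u_k)=1$ if $i,j,k$ are pairwise distinct, and $0$ otherwise; (2) $\phi(u\cdot u',v,w)=\phi(u,v,w)+\phi(u',v,w)$, and similarly in the second and third variables. The algebra $\mathcal{A}^{\mathbb{R}}$ is the unital (non-associative) real algebra generated by $u_1,\ldots,u_n$ with relations: $u_i^2=1$ for $i\le p$ and $u_i^2=-1$ for $i>p$; either all generators pairwise anticommute or all generators pairwise commute (two separate cases); and $u\cdot(v\cdot w)=(-1)^{\phi(u,v,w)}(u\cdot v)\cdot w$ for all monomials $u,v,w\in X_n$. The algebra $\mathcal{A}^{\mathbb{C}}$ is the unital complex algebra with the same relations, where for the squares one may take $u_i^2=1$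 for all $i$. Target algebras. For $\mathbb{K}=\mathbb{R}$ or $\mathbb{C}$ and $f:(\mathbb{Z}_2)^n\times(\mathbb{Z}_2)^n\to\mathbb{Z}_2$ with $f(0,\cdot)=f(\cdot,0)=0$, $(\mathbb{K}[(\mathbb{Z}_2)^n],f)$ denotes the $\mathbb{K}$-algebra with basis $u_x$, $x\in(\mathbb{Z}_2)^n$, and product $u_x\cdot u_y=(-1)^{f(x,y)}u_{x+y}$. Put $$f_{\mathbb{M}}(x,y)=\sum_{1\le i<j<k\le n}(x_ix_jy_k+x_iy_jx_k+y_ix_jx_k),\qquad f_{\mathbb{O}}(x,y)=f_{\mathbb{M}}(x,y)+\sum_{1\le i\le j\le n}x_iy_j .$$ Then $\mathbb{O}_n=(\mathbb{C}[(\mathbb{Z}_2)^n],f_{\mathbb{O}})$, $\mathbb{M}_n=(\mathbb{C}[(\mathbb{Z}_2)^n],f_{\mathbb{M}})$, $\mathbb{O}_{p,q}=(\mathbb{R}[(\mathbb{Z}_2)^n],f_{\mathbb{O}}+\sum_{1\le i\le p}x_iy_i)$ and $\mathbb{M}_{p,q}=(\mathbb{R}[(\mathbb{Z}_2)^n],f_{\mathbb{M}}+\sum_{p<i\le n}x_iy_i)$; thus in both $\mathbb{O}_{p,q}$ and $\mathbb{M}_{p,q}$ the basis element indexed by the $i$-th standard basis vector squares to $1$ for $i\le p$ and to $-1$ for $i>p$. *)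

(* Defs.v *)
From HB Require Import structures.
From mathcomp Require Import all_boot all_order all_algebra.
From mathcomp Require Import boolp reals complex.
From mathcomp Require Import finmap monalg.

Set Implicit Arguments.
Unset Strict Implicit.
Unset Printing Implicit Defensive.

Import GRing.Theory.
Local Open Scope ring_scope.

Local Notation "x · y" := (@monoid.mul _ x y)
  (at level 40, left associativity).
Local Notation "''1'" := (@monoid.one _).

(** * Unital, not necessarily associative algebras *)

(* MathComp's algebra structures are all associative; here the product and its
   unit are those of a unital magma (written in [group_scope] outside this
   file), which is not assumed associative. *)
HB.mixin Record isBilinearMul (K : pzRingType) A
    of GRing.Lmodule K A & UMagma A := {
  namulDl : forall x y z : A, (x + y) · z = x · z + y · z;
  namulDr : forall x y z : A, x · (y + z) = x · y + x · z;
  namulZl : forall (a : K) (x y : A), (a *: x) · y = a *: (x · y);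
  namulZr : forall (a : K) (x y : A), x · (a *: y) = a *: (x · y)
}.

#[short(type="naAlgType")]
HB.structure Definition NAAlgebra (K : pzRingType) :=
  {A of isBilinearMul K A & GRing.Lmodule K A & UMagma A}.

Definition na_isomorphic (K : pzRingType) (A B : naAlgType K) : Prop :=
  exists g : A -> B,
    [/\ bijective g, linear g, g '1 = '1 & {morph g : x y / x · y}].

Notation "A ≅ B" := (na_isomorphic A B) (at level 70).

Section NAAlgebraTheory.
Variables (K : pzRingType) (A : naAlgType K).
Implicit Types x y z : A.

Lemma na0mul x : 0 · x = 0.
Proof. by rewrite -[X in X · x](scale0r 0) namulZl scale0r. Qed.

Lemma namul0 x : x · 0 = 0.
Proof. by rewrite -[X in x · X](scale0r 0) namulZr scale0r. Qed.

Lemma namulBl x y z : (x - y) · z = x · z - y · z.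
Proof. by rewrite -scaleN1r namulDl namulZl scaleN1r. Qed.

Lemma namulBr x y z : x · (y - z) = x · y - x · z.
Proof. by rewrite -scaleN1r namulDr namulZr scaleN1r. Qed.

Lemma namul_suml I (r : seq I) (P : pred I) (F : I -> A) x :
  (\sum_(i <- r | P i) F i) · x = \sum_(i <- r | P i) F i · x.
Proof.
by apply: (big_morph (fun y => y · x)) => [y z|]; rewrite ?namulDl ?na0mul.
Qed.

Lemma namul_sumr I (r : seq I) (P : pred I) (F : I -> A) x :
  x · (\sum_(i <- r | P i) F i) = \sum_(i <- r | P i) x · F i.
Proof.
by apply: (big_morph (fun y => x · y)) => [y z|]; rewrite ?namulDr ?namul0.
Qed.

End NAAlgebraTheory.

(** * Quotient by the two-sided ideal generated by a set of relators *)

Section Ideal.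
Variables (K : pzRingType) (A : naAlgType K).

Definition na_ideal (I : A -> Prop) : Prop :=
  [/\ I 0, forall x y, I x -> I y -> I (x + y),
      forall (a : K) x, I x -> I (a *: x),
      forall x y, I y -> I (x · y) & forall x y, I x -> I (x · y)].

Definition ideal_gen (S : A -> Prop) (x : A) : Prop :=
  forall I, na_ideal I -> (forall y, S y -> I y) -> I x.

Lemma ideal_gen_ideal S : na_ideal (ideal_gen S).
Proof.
split.
- by move=> I [].
- by move=> x y Sx Sy I idI SI; case: (idI) => _ ID _ _ _;
    apply: ID; [exact: Sx | exact: Sy].
- by move=> a x Sx I idI SI; case: (idI) => _ _ IZ _ _; apply: IZ; exact: Sx.
- by move=> x y Sy I idI SI; case: (idI) => _ _ _ IM _; apply: IM; exact: Sy.
- by move=> x y Sx I idI SI; case: (idI) => _ _ _ _ IM; apply: IM; exact: Sx.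
Qed.

Lemma ideal_gen_sub S x : S x -> ideal_gen S x.
Proof. by move=> Sx I _; apply. Qed.

(* The boolean form is needed by MathComp's quotient construction. *)
Definition ideal_pred (S : A -> Prop) : {pred A} := fun x => `[< ideal_gen S x >].

Lemma ideal_predP S x : reflect (ideal_gen S x) (x \in ideal_pred S).
Proof. exact: asboolP. Qed.

Fact ideal_pred_zmod_closed S : zmod_closed (ideal_pred S).
Proof.
have [I0 ID IZ _ _] := ideal_gen_ideal S.
split=> [|x y /ideal_predP Ix /ideal_predP Iy]; apply/ideal_predP => //.
by rewrite -scaleN1r; apply: ID => //; apply: IZ.
Qed.

HB.instance Definition _ S :=
  GRing.isZmodClosed.Build A (ideal_pred S) (ideal_pred_zmod_closed S).

End Ideal.

Section Quotient.
Local Open Scope quotient_scope.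
Variables (K : pzRingType) (A : naAlgType K) (S : A -> Prop).

Definition na_quot := Quotient.quot (ideal_pred S).
HB.instance Definition _ := GRing.Zmodule.on na_quot.
HB.instance Definition _ := EqQuotient.on na_quot.

Definition na_pi (x : A) : na_quot := \pi_na_quot x.

Lemma na_piP x y : reflect (na_pi x = na_pi y) (x - y \in ideal_pred S).
Proof. by rewrite Quotient.idealrBE; exact: eqP. Qed.

Lemma na_pi_surj (q : na_quot) : exists x, na_pi x = q.
Proof. by exists (repr q); exact: reprK. Qed.

Lemma na_piD : {morph na_pi : x y / x + y}.
Proof. by move=> x y; rewrite /na_pi !piE. Qed.

Lemma na_piB : {morph na_pi : x y / x - y}.
Proof. by move=> x y; rewrite /na_pi !piE. Qed.

Lemma repr_na_pi x : repr (na_pi x) - x \in ideal_pred S.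
Proof. by apply/na_piP; exact: reprK. Qed.

Definition na_quot_scale (a : K) (q : na_quot) : na_quot := na_pi (a *: repr q).
Definition na_quot_mul (q r : na_quot) : na_quot := na_pi (repr q · repr r).
Definition na_quot_one : na_quot := na_pi '1.

Lemma na_quot_scaleE a x : na_quot_scale a (na_pi x) = na_pi (a *: x).
Proof.
apply/na_piP/ideal_predP; rewrite -scalerBr.
by have [_ _ IZ _ _] := ideal_gen_ideal S; apply: IZ; apply/ideal_predP; exact: repr_na_pi.
Qed.

Lemma na_quot_mulE x y : na_quot_mul (na_pi x) (na_pi y) = na_pi (x · y).
Proof.
apply/na_piP/ideal_predP; set x' := repr _; set y' := repr _.
rewrite -(subrK (x · y') (x' · y')) -addrA -namulBl -namulBr.
have [_ ID _ IMr IMl] := ideal_gen_ideal S.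
by apply: ID; [apply: IMl | apply: IMr]; apply/ideal_predP; exact: repr_na_pi.
Qed.

Fact na_quot_scaleA a b q :
  na_quot_scale a (na_quot_scale b q) = na_quot_scale (a * b) q.
Proof. by have [x <-] := na_pi_surj q; rewrite !na_quot_scaleE scalerA. Qed.

Fact na_quot_scale1 : left_id 1 na_quot_scale.
Proof. by move=> q; have [x <-] := na_pi_surj q; rewrite !na_quot_scaleE scale1r. Qed.

Fact na_quot_scaleDr : right_distributive na_quot_scale +%R.
Proof.
move=> a q r; have [x <-] := na_pi_surj q; have [y <-] := na_pi_surj r.
by rewrite -na_piD !na_quot_scaleE scalerDr na_piD.
Qed.

Fact na_quot_scaleDl q : {morph na_quot_scale^~ q : a b / a + b}.
Proof.
move=> a b; have [x <-] := na_pi_surj q.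
by rewrite !na_quot_scaleE scalerDl na_piD.
Qed.

HB.instance Definition _ := GRing.Zmodule_isLmodule.Build K na_quot
  na_quot_scaleA na_quot_scale1 na_quot_scaleDr na_quot_scaleDl.

HB.instance Definition _ := hasMul.Build na_quot na_quot_mul.

Fact na_quot_mul1g : left_id na_quot_one na_quot_mul.
Proof.
by move=> q; have [x <-] := na_pi_surj q; rewrite na_quot_mulE mul1g.
Qed.

Fact na_quot_mulg1 : right_id na_quot_one na_quot_mul.
Proof.
by move=> q; have [x <-] := na_pi_surj q; rewrite na_quot_mulE mulg1.
Qed.

HB.instance Definition _ :=
  Magma_isUMagma.Build na_quot na_quot_mul1g na_quot_mulg1.

Lemma na_piZ a : {morph na_pi : x / a *: x}.
Proof. by move=> x; rewrite -na_quot_scaleE. Qed.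

Lemma na_piM : {morph na_pi : x y / x · y}.
Proof. by move=> x y; rewrite -na_quot_mulE. Qed.

Lemma na_pi1 : na_pi '1 = '1.
Proof. by []. Qed.

Fact na_quot_mulDl (q r s : na_quot) : (q + r) · s = q · s + r · s.
Proof.
have [x <-] := na_pi_surj q; have [y <-] := na_pi_surj r.
by have [z <-] := na_pi_surj s; rewrite -na_piD -!na_piM namulDl na_piD.
Qed.

Fact na_quot_mulDr (q r s : na_quot) : q · (r + s) = q · r + q · s.
Proof.
have [x <-] := na_pi_surj q; have [y <-] := na_pi_surj r.
by have [z <-] := na_pi_surj s; rewrite -na_piD -!na_piM namulDr na_piD.
Qed.

Fact na_quot_mulZl a (q r : na_quot) : (a *: q) · r = a *: (q · r).
Proof.
have [x <-] := na_pi_surj q; have [y <-] := na_pi_surj r.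
by rewrite -na_piZ -!na_piM namulZl na_piZ.
Qed.

Fact na_quot_mulZr a (q r : na_quot) : q · (a *: r) = a *: (q · r).
Proof.
have [x <-] := na_pi_surj q; have [y <-] := na_pi_surj r.
by rewrite -na_piZ -!na_piM namulZr na_piZ.
Qed.

HB.instance Definition _ := isBilinearMul.Build K na_quot
  na_quot_mulDl na_quot_mulDr na_quot_mulZl na_quot_mulZr.

End Quotient.

(** * Non-associative monomials and the free unital algebra *)

Inductive monomial (n : nat) : Type :=
  | Gen of 'I_n
  | Mul of monomial n & monomial n.

Section MonomialChoice.
Variable n : nat.

Fixpoint tree_of_monomial (u : monomial n) : GenTree.tree 'I_n :=
  match u with
  | Gen i => GenTree.Leaf i
  | Mul v w => GenTree.Node 0 [:: tree_of_monomial v; tree_of_monomial w]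
  end.

Fixpoint monomial_of_tree (t : GenTree.tree 'I_n) : option (monomial n) :=
  match t with
  | GenTree.Leaf i => Some (Gen i)
  | GenTree.Node _ [:: t1; t2] =>
      match monomial_of_tree t1, monomial_of_tree t2 with
      | Some u, Some v => Some (Mul u v)
      | _, _ => None
      end
  | _ => None
  end.

Fact tree_of_monomialK : pcancel tree_of_monomial monomial_of_tree.
Proof. by elim=> //= u -> v ->. Qed.

HB.instance Definition _ := Countable.copy (monomial n) (pcan_type tree_of_monomialK).
HB.instance Definition _ := hasMul.Build (monomial n) (@Mul n).

End MonomialChoice.

(* Monomials together with the empty one, [None]: the free unital magma. *)
Definition umonomial (n : nat) := option (monomial n).

Section UMonomial.
Variable n : nat.

HB.instance Definition _ := Countable.on (umonomial n).

Definition umonomial_mul (u v : umonomial n) : umonomial n :=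
  match u, v with
  | None, _ => v
  | _, None => u
  | Some u', Some v' => Some (Mul u' v')
  end.

HB.instance Definition _ := hasMul.Build (umonomial n) umonomial_mul.

Fact umonomial_mul1g : left_id None umonomial_mul.
Proof. by []. Qed.

Fact umonomial_mulg1 : right_id None umonomial_mul.
Proof. by case. Qed.

HB.instance Definition _ :=
  Magma_isUMagma.Build (umonomial n) umonomial_mul1g umonomial_mulg1.

End UMonomial.

(* Finite [K]-linear combinations of elements of a unital magma [M], with the
   bilinear extension of the product of [M]. *)
Definition magma_alg (K : comNzRingType) (M : umagmaType) := {malg K[M]}.

Section MagmaAlgebra.
Variables (K : comNzRingType) (M : umagmaType).
Local Notation alg := (magma_alg K M).

HB.instance Definition _ := GRing.Lmodule.on alg.

Definition magma_alg_mul (x y : alg) : alg :=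
  \sum_(u <- msupp x) \sum_(v <- msupp y) << x@_u * y@_v *g u · v >>.

HB.instance Definition _ := hasMul.Build alg magma_alg_mul.

Lemma magma_algMw (D E : {fset M}) (x y : alg) :
    (msupp x `<=` D)%fset -> (msupp y `<=` E)%fset ->
  x · y = \sum_(u <- D) \sum_(v <- E) << x@_u * y@_v *g u · v >>.
Proof.
move=> sD sE; rewrite {1}/monoid.mul /= /magma_alg_mul.
rewrite (big_fset_incl _ sD) /=; last first.
  by move=> u _ /mcoeff_outdom ->; rewrite big1 // => v _; rewrite mul0r monalgU0.
apply: eq_bigr => u _; rewrite (big_fset_incl _ sE) //=.
by move=> v _ /mcoeff_outdom ->; rewrite mulr0 monalgU0.
Qed.

Lemma magma_algUU (a b : K) (u v : M) :
  (<< a *g u >> : alg) · (<< b *g v >> : alg) = << a * b *g u · v >>.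
Proof.
rewrite (@magma_algMw [fset u]%fset [fset v]%fset) ?msuppU_le //.
by rewrite !big_seq_fset1 !mcoeffUU.
Qed.

Fact magma_alg_mulDl (x y z : alg) : (x + y) · z = x · z + y · z.
Proof.
pose D := (msupp x `|` msupp y)%fset.
rewrite (@magma_algMw D (msupp z)) ?msuppD_le //.
rewrite (@magma_algMw D (msupp z) x) ?fsubsetUl //.
rewrite (@magma_algMw D (msupp z) y) ?fsubsetUr //.
rewrite -big_split; apply: eq_bigr => u _; rewrite -big_split.
by apply: eq_bigr => v _; rewrite mcoeffD mulrDl monalgUD.
Qed.

Fact magma_alg_mulDr (x y z : alg) : x · (y + z) = x · y + x · z.
Proof.
pose E := (msupp y `|` msupp z)%fset.
rewrite (@magma_algMw (msupp x) E) ?msuppD_le //.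
rewrite (@magma_algMw (msupp x) E x y) ?fsubsetUl //.
rewrite (@magma_algMw (msupp x) E x z) ?fsubsetUr //.
rewrite -big_split; apply: eq_bigr => u _; rewrite -big_split.
by apply: eq_bigr => v _; rewrite mcoeffD mulrDr monalgUD.
Qed.

Lemma magma_algZU (a b : K) (u : M) : a *: (<< b *g u >> : alg) = << a * b *g u >>.
Proof.
by apply/malgP => v; rewrite mcoeffZ !mcoeffU mulrnAr.
Qed.

Fact magma_alg_mulZl a (x y : alg) : (a *: x) · y = a *: (x · y).
Proof.
rewrite (@magma_algMw (msupp x) (msupp y)) ?msuppZ_le //.
rewrite scaler_sumr; apply: eq_bigr => u _; rewrite scaler_sumr.
by apply: eq_bigr => v _; rewrite mcoeffZ magma_algZU mulrA.
Qed.

Fact magma_alg_mulZr a (x y : alg) : x · (a *: y) = a *: (x · y).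
Proof.
rewrite (@magma_algMw (msupp x) (msupp y)) ?msuppZ_le //.
rewrite scaler_sumr; apply: eq_bigr => u _; rewrite scaler_sumr.
by apply: eq_bigr => v _; rewrite mcoeffZ magma_algZU mulrCA.
Qed.

Definition magma_alg_one : alg := << '1 : M >>.

Fact magma_alg_mul1g : left_id magma_alg_one magma_alg_mul.
Proof.
move=> x; change (magma_alg_one · x = x).
rewrite (@magma_algMw [fset '1]%fset (msupp x)) ?msuppU_le //.
rewrite big_seq_fset1 [RHS]monalgE; apply: eq_bigr => u _.
by rewrite mcoeffUU mul1r mul1g.
Qed.

Fact magma_alg_mulg1 : right_id magma_alg_one magma_alg_mul.
Proof.
move=> x; change (x · magma_alg_one = x).
rewrite (@magma_algMw (msupp x) [fset '1]%fset) ?msuppU_le //.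
rewrite [RHS]monalgE; apply: eq_bigr => u _; rewrite big_seq_fset1.
by rewrite mcoeffUU mulr1 mulg1.
Qed.

HB.instance Definition _ :=
  Magma_isUMagma.Build alg magma_alg_mul1g magma_alg_mulg1.

HB.instance Definition _ := isBilinearMul.Build K alg
  magma_alg_mulDl magma_alg_mulDr magma_alg_mulZl magma_alg_mulZr.

End MagmaAlgebra.

Definition free_alg (K : comNzRingType) (n : nat) : naAlgType K :=
  magma_alg K (umonomial n).

Definition mon (K : comNzRingType) (n : nat) (u : monomial n) : free_alg K n :=
  << (Some u : umonomial n) >>.

Lemma monM K n (u v : monomial n) : mon K (u · v) = mon K u · mon K v.
Proof. by rewrite /mon magma_algUU mulr1. Qed.

(** * The associator sign and the presented algebras *)

Section Phi.
Variable n : nat.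

Definition phi_gen (i j k : 'I_n) : 'F_2 :=
  ([&& i != j, j != k & i != k] : bool)%:R.

Fixpoint phi3 (i j : 'I_n) (w : monomial n) : 'F_2 :=
  match w with
  | Gen k => phi_gen i j k
  | Mul w1 w2 => phi3 i j w1 + phi3 i j w2
  end.

Fixpoint phi2 (i : 'I_n) (v w : monomial n) : 'F_2 :=
  match v with
  | Gen j => phi3 i j w
  | Mul v1 v2 => phi2 i v1 w + phi2 i v2 w
  end.

Fixpoint phi (u v w : monomial n) : 'F_2 :=
  match u with
  | Gen i => phi2 i v w
  | Mul u1 u2 => phi u1 v w + phi u2 v w
  end.

Definition phi_spec (f : monomial n -> monomial n -> monomial n -> 'F_2) : Prop :=
  [/\ forall i j k, f (Gen i) (Gen j) (Gen k) = phi_gen i j k,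
      forall u u' v w, f (u · u') v w = f u v w + f u' v w,
      forall u v v' w, f u (v · v') w = f u v w + f u v' w
    & forall u v w w', f u v (w · w') = f u v w + f u v w'].

Lemma phiP : phi_spec phi.
Proof.
split=> //.
- by move=> + v v' w; elim=> //= u1 -> u2 ->; rewrite addrACA.
- move=> + + w w'; elim=> [i|u1 IH1 u2 IH2] v /=; last first.
    by rewrite IH1 IH2 addrACA.
  by elim: v => //= v1 -> v2 ->; rewrite addrACA.
Qed.

Lemma phi_uniq f : phi_spec f -> forall u v w, f u v w = phi u v w.
Proof.
case=> fG fl fm fr; elim=> [i|u1 IH1 u2 IH2] v w; last first.
  by rewrite (fl u1 u2) IH1 IH2.
elim: v => [j|v1 IH1 v2 IH2]; last by rewrite (fm _ v1 v2) IH1 IH2.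
by elim: w => [k|w1 IH1 w2 IH2]; [exact: fG | rewrite (fr _ _ w1 w2) IH1 IH2].
Qed.

End Phi.

(* Generators are indexed from 0, so those of square 1 are the [i < p]. The
   boolean [anti] selects anticommuting or commuting generators. *)
Section Presentation.
Variables (K : comNzRingType) (n p : nat) (anti : bool).
Local Notation u i := (mon K (@Gen n i)).

Inductive relator : free_alg K n -> Prop :=
  | RelSquare i : relator (u i · u i - (-1) ^+ (p <= i)%N *: '1)
  | RelSwap i j of i != j : relator (u i · u j - (-1) ^+ anti *: (u j · u i))
  | RelAssoc (x y z : monomial n) :
      relator (mon K x · (mon K y · mon K z)
               - (-1) ^+ phi x y z *: (mon K x · mon K y · mon K z)).

Definition presented_alg : naAlgType K := na_quot relator.

End Presentation.

(* The signs of the squares are kept over any scalars; [p = n] gives the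
   presentation in which every generator has square 1. *)
Definition anticommuting_alg (K : comNzRingType) (n p : nat) : naAlgType K :=
  presented_alg K n p true.
Definition commuting_alg (K : comNzRingType) (n p : nat) : naAlgType K :=
  presented_alg K n p false.

(** * Twisted group algebras of [(Z_2)^n] *)

Local Notation Z2 n := 'rV['F_2]_n.

Record twist (n : nat) := Twist {
  twist_fun :> Z2 n -> Z2 n -> 'F_2;
  twist0l : forall x, twist_fun 0 x = 0;
  twist0r : forall x, twist_fun x 0 = 0
}.

Definition twisted_alg (K : comNzRingType) (n : nat) (f : twist n) :=
  {ffun Z2 n -> K^o}.

Section TwistedAlgebra.
Variables (K : comNzRingType) (n : nat) (f : twist n).
Local Notation alg := (twisted_alg K f).
Implicit Types (a b c : alg) (x y : Z2 n).

HB.instance Definition _ := GRing.Lmodule.on alg.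

Definition tw_basis x : alg := [ffun y => (y == x)%:R].

Definition tw_mul a b : alg :=
  \sum_x \sum_y (a x * b y * (-1) ^+ f x y) *: tw_basis (x + y).

HB.instance Definition _ := hasMul.Build alg tw_mul.

Lemma tw_basisE a : a = \sum_x a x *: tw_basis x.
Proof.
apply/ffunP => y; rewrite sum_ffunE (bigD1 y) //= big1 => [|x /negPf nxy].
  by rewrite !ffunE eqxx addr0 [_ *: _]mulr1.
by rewrite !ffunE eq_sym nxy [_ *: _]mulr0.
Qed.

Lemma tw_mul_basis x y :
  tw_basis x · tw_basis y = (-1) ^+ f x y *: tw_basis (x + y).
Proof.
rewrite {1}/monoid.mul /= /tw_mul (bigD1 x) //= [X in _ + X]big1; last first.
  move=> x' /negPf nx; rewrite big1 // => y' _.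
  by rewrite !ffunE nx !mul0r scale0r.
rewrite addr0 (bigD1 y) //= big1 => [|y' /negPf ny]; last first.
  by rewrite !ffunE ny mulr0 mul0r scale0r.
by rewrite !ffunE !eqxx !mul1r addr0.
Qed.

Fact tw_mulDl a b c : (a + b) · c = a · c + b · c.
Proof.
rewrite /monoid.mul /= /tw_mul -big_split; apply: eq_bigr => x _.
rewrite -big_split; apply: eq_bigr => y _.
by rewrite ffunE !mulrDl scalerDl.
Qed.

Fact tw_mulDr a b c : a · (b + c) = a · b + a · c.
Proof.
rewrite /monoid.mul /= /tw_mul -big_split; apply: eq_bigr => x _.
rewrite -big_split; apply: eq_bigr => y _.
by rewrite ffunE mulrDr mulrDl scalerDl.
Qed.

Fact tw_mulZl (k : K) a b : (k *: a) · b = k *: (a · b).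
Proof.
rewrite /monoid.mul /= /tw_mul scaler_sumr; apply: eq_bigr => x _.
rewrite scaler_sumr; apply: eq_bigr => y _.
by rewrite ffunE scalerA !mulrA.
Qed.

Fact tw_mulZr (k : K) a b : a · (k *: b) = k *: (a · b).
Proof.
rewrite /monoid.mul /= /tw_mul scaler_sumr; apply: eq_bigr => x _.
rewrite scaler_sumr; apply: eq_bigr => y _.
by rewrite ffunE scalerA [a x * _]mulrCA !mulrA.
Qed.

Fact tw_mul1g : left_id (tw_basis 0) tw_mul.
Proof.
move=> a; rewrite /tw_mul (bigD1 0) //= [X in _ + X]big1 => [|x /negPf nx].
  rewrite addr0 [RHS]tw_basisE; apply: eq_bigr => y _.
  by rewrite ffunE eqxx mul1r twist0l expr0 mulr1 add0r.
by rewrite big1 // => y _; rewrite ffunE nx !mul0r scale0r.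
Qed.

Fact tw_mulg1 : right_id (tw_basis 0) tw_mul.
Proof.
move=> a; rewrite /tw_mul [RHS]tw_basisE; apply: eq_bigr => x _.
rewrite (bigD1 0) //= big1 => [|y /negPf ny].
  by rewrite addr0 ffunE eqxx mulr1 twist0r expr0 mulr1 addr0.
by rewrite ffunE ny mulr0 mul0r scale0r.
Qed.

HB.instance Definition _ := Magma_isUMagma.Build alg tw_mul1g tw_mulg1.
HB.instance Definition _ := isBilinearMul.Build K alg
  tw_mulDl tw_mulDr tw_mulZl tw_mulZr.

End TwistedAlgebra.

(** * The algebras O and M *)

Section Cubic.
Variable n : nat.
Implicit Types x y : Z2 n.

Definition f_M x y : 'F_2 :=
  \sum_(i < n) \sum_(j < n) \sum_(k < n | (i < j < k)%N)
    (x ord0 i * x ord0 j * y ord0 k + x ord0 i * y ord0 j * x ord0 k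
     + y ord0 i * x ord0 j * x ord0 k).

Definition f_O x y : 'F_2 :=
  f_M x y + \sum_(i < n) \sum_(j < n | (i <= j)%N) x ord0 i * y ord0 j.

Definition f_Opq (p : nat) x y : 'F_2 :=
  f_O x y + \sum_(i < n | (i < p)%N) x ord0 i * y ord0 i.

Definition f_Mpq (p : nat) x y : 'F_2 :=
  f_M x y + \sum_(i < n | (p <= i)%N) x ord0 i * y ord0 i.

Fact f_M0l x : f_M 0 x = 0.
Proof.
rewrite /f_M big1 // => i _; rewrite big1 // => j _; rewrite big1 // => k _.
by rewrite !mxE !(mul0r, mulr0, addr0).
Qed.

Fact f_M0r x : f_M x 0 = 0.
Proof.
rewrite /f_M big1 // => i _; rewrite big1 // => j _; rewrite big1 // => k _.
by rewrite !mxE !(mul0r, mulr0, addr0).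
Qed.

Fact f_O0l x : f_O 0 x = 0.
Proof.
rewrite /f_O f_M0l add0r big1 // => i _; rewrite big1 // => j _.
by rewrite mxE mul0r.
Qed.

Fact f_O0r x : f_O x 0 = 0.
Proof.
rewrite /f_O f_M0r add0r big1 // => i _; rewrite big1 // => j _.
by rewrite mxE mulr0.
Qed.

Fact f_Opq0l p x : f_Opq p 0 x = 0.
Proof. by rewrite /f_Opq f_O0l add0r big1 // => i _; rewrite mxE mul0r. Qed.

Fact f_Opq0r p x : f_Opq p x 0 = 0.
Proof. by rewrite /f_Opq f_O0r add0r big1 // => i _; rewrite mxE mulr0. Qed.

Fact f_Mpq0l p x : f_Mpq p 0 x = 0.
Proof. by rewrite /f_Mpq f_M0l add0r big1 // => i _; rewrite mxE mul0r. Qed.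

Fact f_Mpq0r p x : f_Mpq p x 0 = 0.
Proof. by rewrite /f_Mpq f_M0r add0r big1 // => i _; rewrite mxE mulr0. Qed.

End Cubic.

Section OM.
Variables (K : comNzRingType) (n p : nat).

Definition O_alg : naAlgType K := twisted_alg K (Twist (@f_O0l n) (@f_O0r n)).
Definition M_alg : naAlgType K := twisted_alg K (Twist (@f_M0l n) (@f_M0r n)).

(* O_{p,q} and M_{p,q}, with q = n - p left implicit. *)
Definition Opq_alg : naAlgType K :=
  twisted_alg K (Twist (@f_Opq0l n p) (@f_Opq0r n p)).
Definition Mpq_alg : naAlgType K :=
  twisted_alg K (Twist (@f_Mpq0l n p) (@f_Mpq0r n p)).

End OM.

(* Main.v *)
(* In the presented algebra A, multiplication of monomials is associative and
   commutative up to sign, and generators square to the unit up to sign. So the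
   classes of monomials modulo sign form a quotient of (Z_2)^n, and A is spanned
   by 2^n ordered monomials. Conversely u_i |-> s_i e_i, for scalars s_i that
   correct the squares, defines a morphism from A to the twisted group algebra:
   the associativity relations hold because the coboundary of the cubic function
   f_M is the trilinear function phi, while bilinear terms have coboundary 0. It
   maps the ordered monomials to nonzero multiples of the basis vectors, hence
   is bijective. *)
Require Import Defs.
From mathcomp Require Import all_boot all_order all_algebra.
From mathcomp Require Import reals complex.
From mathcomp Require Import finmap monalg zify ring.

Set Implicit Arguments.
Unset Strict Implicit.
Unset Printing Implicit Defensive.

Import GRing.Theory Num.Theory.
Local Open Scope ring_scope.

Local Notation "x · y" := (@monoid.mul _ x y)
  (at level 40, left associativity).
Local Notation "''1'" := (@monoid.one _).
Local Notation Z2 n := 'rV['F_2]_n.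

(** * Signs with exponents in the two-element field *)

Section F2.

Lemma F2_addrr (a : 'F_2) : a + a = 0.
Proof. by apply/eqP; case: a => [[|[]]]. Qed.

Lemma signr_F2D (R : pzRingType) (a b : 'F_2) :
  (-1) ^+ (a + b)%R = (-1) ^+ a * (-1) ^+ b :> R.
Proof.
by case: a b => [[|[]] // ?] [[|[]] // ?];
  rewrite /= ?expr0 ?expr1 ?mulr1 ?mul1r ?mulrNN ?mulr1.
Qed.

Lemma signr_F2b (R : pzRingType) (b : bool) :
  (-1) ^+ (b%:R : 'F_2) = (-1) ^+ b :> R.
Proof. by case: b. Qed.

Lemma F2_neq0 (a : 'F_2) : a != 0 -> a = 1.
Proof. by move=> a0; apply/eqP; case: a a0 => [[|[]]]. Qed.

End F2.

(** * Coboundaries of twisting functions and the cubic form *)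

Section Coboundary.
Variable n : nat.
Implicit Types (x y z : Z2 n) (f g : Z2 n -> Z2 n -> 'F_2).

(** The first two terms are the exponent of (e_x e_y) e_z, the last two that of e_x (e_y e_z); their
    sum is the exponent of the associator sign, minus signs being immaterial modulo 2. *)
Definition coboundary f x y z : 'F_2 :=
  f x y + f (x + y) z + (f y z + f x (y + z)).

(** This is the trilinear form on (Z_2)^n through which [phi] factors, by way of the degrees of
    monomials. *)
Definition alt_cubic x y z : 'F_2 :=
  \sum_i \sum_j \sum_k phi_gen i j k * (x ord0 i * y ord0 j * z ord0 k).

Lemma coboundaryD f g x y z :
  coboundary (fun x y => f x y + g x y) x y z =
  coboundary f x y z + coboundary g x y z.
Proof. by rewrite /coboundary; ring. Qed.

(** After expansion each of [f x y], [f x z], [f y z] occurs exactly twice. *)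
Lemma coboundary_bilinear f :
  (forall x y z, f (x + y) z = f x z + f y z) ->
  (forall x y z, f x (y + z) = f x y + f x z) ->
  forall x y z, coboundary f x y z = 0.
Proof.
move=> fDl fDr x y z; rewrite /coboundary fDl fDr.
have -> : f x y + (f x z + f y z) + (f y z + (f x y + f x z)) =
  (f x y + f x z + f y z) + (f x y + f x z + f y z) by ring.
exact: F2_addrr.
Qed.

Lemma coboundary_sum_pairs (P : rel 'I_n) x y z :
  coboundary (fun x y => \sum_i \sum_(j | P i j) x ord0 i * y ord0 j) x y z = 0.
Proof.
apply: coboundary_bilinear => {}x {}y {}z.
  rewrite -big_split; apply: eq_bigr => i _; rewrite -big_split.
  by apply: eq_bigr => j _; rewrite mxE mulrDl.
rewrite -big_split; apply: eq_bigr => i _; rewrite -big_split.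
by apply: eq_bigr => j _; rewrite mxE mulrDr.
Qed.

Lemma coboundary_sum_diag (P : pred 'I_n) x y z :
  coboundary (fun x y => \sum_(i | P i) x ord0 i * y ord0 i) x y z = 0.
Proof.
apply: coboundary_bilinear => {}x {}y {}z; rewrite -big_split;
  by apply: eq_bigr => i _; rewrite mxE (mulrDl, mulrDr).
Qed.

(** The six strict orderings exclude one another, and one of them holds exactly when the indices are
    pairwise distinct. *)
Lemma phi_gen_orderings (i j k : 'I_n) :
  phi_gen i j k =
    (i < j < k)%N%:R + (i < k < j)%N%:R + (j < i < k)%N%:R
    + (k < i < j)%N%:R + (j < k < i)%N%:R + (k < j < i)%N%:R.
Proof.
rewrite /phi_gen -!(inj_eq val_inj) /=.
by case: (ltngtP i j) => ij; case: (ltngtP j k) => jk;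
  case: (ltngtP i k) => ik; rewrite /= ?addr0 ?add0r //; lia.
Qed.

Lemma coboundary_f_M x y z : coboundary (@f_M n) x y z = alt_cubic x y z.
Proof.
pose t x y (i j k : 'I_n) : 'F_2 :=
  x ord0 i * x ord0 j * y ord0 k + x ord0 i * y ord0 j * x ord0 k
     + y ord0 i * x ord0 j * x ord0 k.
have fE (u v : Z2 n) : f_M u v =
    \sum_(i < n) \sum_(j < n) \sum_(k < n) (i < j < k)%N%:R * t u v i j k.
  apply: eq_bigr => i _; apply: eq_bigr => j _; rewrite big_mkcond.
  by apply: eq_bigr => k _; case: ifP => _; rewrite ?mul1r ?mul0r.
pose c i j k : 'F_2 := x ord0 i * y ord0 j * z ord0 k.
pose S (F : 'I_n -> 'I_n -> 'I_n -> 'F_2) := \sum_i \sum_j \sum_k F i j k.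
have SD F G : S F + S G = S (fun i j k => F i j k + G i j k).
  rewrite /S -big_split; apply: eq_bigr => i _; rewrite -big_split.
  by apply: eq_bigr => j _; rewrite -big_split.
have Seq F G : (forall i j k, F i j k = G i j k) -> S F = S G.
  by move=> FG; apply: eq_bigr => i _; apply: eq_bigr => j _; apply: eq_bigr.
have S12 F : S F = S (fun i j k => F j i k) by rewrite /S exchange_big.
have S23 F : S F = S (fun i j k => F i k j).
  by apply: eq_bigr => i _; rewrite exchange_big.
pose o (i j k : 'I_n) : 'F_2 := (i < j < k)%N%:R.
(* For fixed i < j < k, expansion leaves the six monomials in which x, y and z each occur once, in
   every arrangement. *)
transitivity (S (fun i j k => o i j k *
   (c i j k + c i k j + c j i k + c j k i + c k i j + c k j i))).
  rewrite /coboundary !fE -!/(S _) !SD; apply: Seq => i j k.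
  rewrite -/(o i j k) -!mulrDr; congr (_ * _).
  (* The terms of [w] occur twice, and the other terms are those of [c]. *)
  pose w := t x y i j k + t x z i j k + t y z i j k.
  rewrite -[RHS]addr0 -(F2_addrr w) /w /t /c !mxE; ring.
(* Renaming the summation indices moves the permutation from [c] to [o], so that [c i j k] becomes a
   common factor and the six orderings add up to [phi_gen]. *)
transitivity (S (fun i j k => o i j k * c i j k)
  + S (fun i j k => o i k j * c i j k) + S (fun i j k => o j i k * c i j k) + S (fun i j k => o k i j * c i j k)
  + S (fun i j k => o j k i * c i j k) + S (fun i j k => o k j i * c i j k)).
  (* Each permutation is undone by adjacent transpositions: one for a transposition of neighbours,
     two for a 3-cycle, three for the reversal. *)
  rewrite [S (fun i j k => o i k j * _)]S23 [S (fun i j k => o j i k * _)]S12.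
  rewrite [S (fun i j k => o k i j * _)]S23 [S (fun i j k => o j i k * _)]S12.
  rewrite [S (fun i j k => o j k i * _)]S12 [S (fun i j k => o i k j * _)]S23.
  rewrite [S (fun i j k => o k j i * _)]S12 [S (fun i j k => o k i j * _)]S23.
  rewrite [S (fun i j k => o j i k * _)]S12.
  rewrite !SD; apply: Seq => i j k; ring.
rewrite !SD; apply: Seq => i j k; rewrite phi_gen_orderings /o /c; ring.
Qed.

End Coboundary.

(** * The (Z_2)^n-degree of a monomial *)

Section Degree.
Variable n : nat.

Fixpoint mon_deg (u : monomial n) : Z2 n :=
  match u with
  | Gen i => delta_mx ord0 i
  | Mul v w => mon_deg v + mon_deg w
  end.

Lemma mon_degM u v : mon_deg (u · v) = mon_deg u + mon_deg v.
Proof. by []. Qed.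

Definition udeg (u : umonomial n) : Z2 n := oapp mon_deg 0 u.

Lemma udegM (u v : umonomial n) : udeg (u · v) = udeg u + udeg v.
Proof. by case: u v => [u|] [v|] //=; rewrite ?add0r ?addr0. Qed.

Lemma delta_rVE (i j : 'I_n) :
  (delta_mx ord0 i : Z2 n) ord0 j = (j == i)%:R.
Proof. by rewrite mxE eqxx. Qed.

(** Degrees are additive, so the form taken on degrees satisfies the conditions that characterise
    [phi]. *)
Lemma alt_cubic_phi u v w :
  alt_cubic (mon_deg u) (mon_deg v) (mon_deg w) = phi u v w.
Proof.
pose g u v w := alt_cubic (mon_deg u) (mon_deg v) (mon_deg w).
apply: (@phi_uniq n g); split=> [i j k|a b c d|a b c d|a b c d].
- rewrite /g /alt_cubic (bigD1 i) //= [X in _ + X]big1 => [|i' /negPf ni].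
    rewrite (bigD1 j) //= [X in _ + X + _]big1 => [|j' /negPf nj].
      rewrite (bigD1 k) //= [X in _ + X + _ + _]big1 => [|k' /negPf nk].
        by rewrite !delta_rVE !eqxx !mulr1 !addr0.
      by rewrite !delta_rVE nk !mulr0.
    by apply: big1 => k' _; rewrite !delta_rVE nj !(mulr0, mul0r).
  apply: big1 => j' _; apply: big1 => k' _.
  by rewrite !delta_rVE ni !(mulr0, mul0r).
all: rewrite /g mon_degM /alt_cubic -big_split; apply: eq_bigr => i _.
all: rewrite -big_split; apply: eq_bigr => j _; rewrite -big_split.
all: by apply: eq_bigr => k _; rewrite [(fun_of_matrix (_ + _)) _ _]mxE /=; ring.
Qed.

End Degree.

(** * Linear extension of a map from a magma to its algebra *)

Section MagmaAlgebraLift.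
Variables (K : comNzRingType) (M : umagmaType).
Local Notation alg := (magma_alg K M).

Lemma magma_alg_ind (P : alg -> Prop) :
    P 0 -> (forall x y, P x -> P y -> P (x + y)) ->
    (forall a x, P x -> P (a *: x)) -> (forall u, P << u >>) ->
  forall x, P x.
Proof.
move=> P0 PD PZ PU x; rewrite [x]monalgE; apply: big_ind => // u _.
by rewrite -[x@_u]mulr1 -magma_algZU; exact: PZ.
Qed.

Variables (B : naAlgType K) (e : M -> B).

Definition magma_lift (x : alg) : B := \sum_(u <- msupp x) x@_u *: e u.

(** Supports can shrink under addition and scaling; a larger common index set lets the sums be
    compared term by term. *)
Lemma magma_liftw (D : {fset M}) (x : alg) : (msupp x `<=` D)%fset ->
  magma_lift x = \sum_(u <- D) x@_u *: e u.
Proof.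
move=> sD; apply: big_fset_incl => // u _ /mcoeff_outdom ->.
by rewrite scale0r.
Qed.

Lemma magma_liftD x y : magma_lift (x + y) = magma_lift x + magma_lift y.
Proof.
pose D := (msupp x `|` msupp y)%fset.
rewrite (@magma_liftw D) ?msuppD_le // (@magma_liftw D x) ?fsubsetUl //.
rewrite (@magma_liftw D y) ?fsubsetUr // -big_split.
by apply: eq_bigr => u _; rewrite mcoeffD scalerDl.
Qed.

Lemma magma_liftZ a x : magma_lift (a *: x) = a *: magma_lift x.
Proof.
rewrite (@magma_liftw (msupp x)) ?msuppZ_le // scaler_sumr.
by apply: eq_bigr => u _; rewrite mcoeffZ scalerA.
Qed.

Lemma magma_liftB x y : magma_lift (x - y) = magma_lift x - magma_lift y.
Proof. by rewrite -scaleN1r magma_liftD magma_liftZ scaleN1r. Qed.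

Lemma magma_lift0 : magma_lift 0 = 0.
Proof. by rewrite -(scale0r 0) magma_liftZ scale0r. Qed.

Lemma magma_liftU u : magma_lift << u >> = e u.
Proof.
rewrite (@magma_liftw [fset u]%fset) ?msuppU_le //.
by rewrite big_seq_fset1 mcoeffUU scale1r.
Qed.

Hypothesis eM : {morph e : u v / u · v}.

Lemma magma_liftM : {morph magma_lift : x y / x · y}.
Proof.
move=> x y; elim/magma_alg_ind: x => [|x1 x2 IH1 IH2|a x IH|u].
- by rewrite na0mul magma_lift0 na0mul.
- by rewrite namulDl !magma_liftD namulDl IH1 IH2.
- by rewrite namulZl !magma_liftZ namulZl IH.
elim/magma_alg_ind: y => [|y1 y2 IH1 IH2|a y IH|v].
- by rewrite namul0 magma_lift0 namul0.
- by rewrite namulDr !magma_liftD namulDr IH1 IH2.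
- by rewrite namulZr !magma_liftZ namulZr IH.
by rewrite magma_algUU mulr1 !magma_liftU eM.
Qed.

End MagmaAlgebraLift.

(** * Normal forms modulo sign in an image of the free algebra satisfying the relations *)

Section NormalForm.
Variables (K : comNzRingType) (n p : nat) (anti : bool) (Q : naAlgType K).
Variable h : free_alg K n -> Q.
Local Notation g i := (Some (Gen i) : umonomial n).

Hypothesis hB : {morph h : x y / x - y}.
Hypothesis hZ : forall a, {morph h : x / a *: x}.
Hypothesis hM : {morph h : x y / x · y}.
Hypothesis h_relator : forall x, relator p anti x -> h x = 0.

Definition hmon (u : umonomial n) : Q := h (<< u >> : free_alg K n).

Lemma hmonM u v : hmon (u · v) = hmon u · hmon v.
Proof. by rewrite -hM magma_algUU mulr1. Qed.

Lemma hmon_relation x y a u v : relator p anti (x - a *: y) ->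
  x = mon K u -> y = mon K v -> hmon (Some u) = a *: hmon (Some v).
Proof.
move=> rel ux vy; move: (h_relator rel).
by rewrite ux vy hB hZ => /subr0_eq.
Qed.

(** The exponent stays existential: to show that normal forms span, the value of the sign is
    irrelevant. *)
Definition eq_up_to_sign (u v : umonomial n) : Prop :=
  exists k : nat, hmon u = (-1) ^+ k *: hmon v.
Local Notation "u ~ v" := (eq_up_to_sign u v) (at level 70).

Lemma sign_refl u : u ~ u.
Proof. by exists 0%N; rewrite scale1r. Qed.

Lemma sign_trans u v w : u ~ v -> v ~ w -> u ~ w.
Proof.
by move=> [k uv] [l vw]; exists (k + l)%N; rewrite uv vw scalerA exprD.
Qed.

Lemma sign_sym u v : u ~ v -> v ~ u.
Proof.
move=> [k uv]; exists k; rewrite uv scalerA -exprD addnn -mul2n exprM sqrrN.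
by rewrite expr1n expr1n scale1r.
Qed.

Lemma sign_mul u u' v v' : u ~ u' -> v ~ v' -> u · v ~ u' · v'.
Proof.
move=> [k uu'] [l vv']; exists (k + l)%N.
by rewrite !hmonM uu' vv' namulZl namulZr scalerA exprD.
Qed.

Lemma sign_assoc u v w : u · (v · w) ~ u · v · w.
Proof.
(* The associativity relators concern nonempty monomials only, so an empty factor is removed by the
   unit laws. *)
have none1 : None = '1 :> umonomial n by [].
case: u => [u|]; last by rewrite none1 !mul1g; exact: sign_refl.
case: v => [v|]; last by rewrite none1 mul1g mulg1; exact: sign_refl.
case: w => [w|]; last by rewrite none1 !mulg1; exact: sign_refl.
exists (phi u v w).
by apply: (hmon_relation (RelAssoc K p anti u v w)); rewrite !monM.
Qed.

Lemma sign_square i : g i · g i ~ '1.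
Proof.
exists (p <= i)%N.
have /h_relator := RelSquare K p anti i.
by rewrite -monM hB hZ => /subr0_eq.
Qed.

Lemma sign_swap i j : g i · g j ~ g j · g i.
Proof.
have [->|nij] := eqVneq i j; first exact: sign_refl.
exists anti.
by apply: (hmon_relation (RelSwap K p anti nij)); rewrite monM.
Qed.

(** The list [s] is arbitrary so that induction can run along it; normal forms take the full
    enumeration. *)
Definition word (x : Z2 n) (s : seq 'I_n) : umonomial n :=
  foldr (fun j w => if x ord0 j == 0 then w else g j · w) '1 s.

Lemma udeg_word_notin (x : Z2 n) s i : i \notin s -> udeg (word x s) ord0 i = 0.
Proof.
elim: s => [|j s IH] /=; first by rewrite mxE.
rewrite inE negb_or => /andP[ij /IH {}IH]; case: ifP => // _.
by rewrite udegM mxE IH delta_rVE (negPf ij) addr0.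
Qed.

Lemma udeg_word_in (x : Z2 n) s i :
  uniq s -> i \in s -> udeg (word x s) ord0 i = x ord0 i.
Proof.
elim: s => //= j s IH /andP[njs us]; rewrite inE => /predU1P[->|si].
  have [xj|/F2_neq0 xj] := eqVneq (x ord0 j) 0.
    by rewrite udeg_word_notin.
  by rewrite udegM mxE udeg_word_notin // addr0 delta_rVE eqxx xj.
have ij : (i == j) = false by apply: contraNF njs => /eqP <-.
by case: ifP => _; rewrite ?udegM ?mxE ?delta_rVE ?ij ?add0r IH.
Qed.

Lemma eq_word (x y : Z2 n) s :
  {in s, forall i, x ord0 i = y ord0 i} -> word x s = word y s.
Proof.
elim: s => //= j s IH xy; rewrite xy ?mem_head // IH // => i si.
by rewrite xy // inE si orbT.
Qed.

(** The generator is moved rightwards through the word to its own place, where it is inserted if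
    absent and cancels by the square relation if present. *)
Lemma sign_gen_word (x : Z2 n) s i : uniq s -> i \in s ->
  g i · word x s ~ word (x + delta_mx ord0 i) s.
Proof.
elim: s => //= j s IH /andP[njs us]; rewrite inE => /predU1P[ij|si].
  rewrite -{j}ij in njs *.
  (* The index i does not recur in the tail, so changing that coordinate leaves the tail
     unchanged. *)
  rewrite (@eq_word (x + delta_mx ord0 i) x s) => [|k sk].
    rewrite mxE delta_rVE eqxx; have [->|/F2_neq0 ->] := eqVneq (x ord0 i) 0.
      by rewrite add0r oner_eq0; exact: sign_refl.
    rewrite F2_addrr eqxx; apply: sign_trans (sign_assoc _ _ _) _.
    exact: sign_mul (sign_square i) (sign_refl _).
  rewrite mxE delta_rVE (_ : k == i = false) ?addr0 //.
  by apply: contraNF njs => /eqP <-.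
rewrite mxE delta_rVE (_ : j == i = false) ?addr0; last first.
  by apply: contraNF njs => /eqP ->.
case: ifP => _; first exact: IH.
(* Up to sign, u_i (u_j w) = (u_i u_j) w = (u_j u_i) w = u_j (u_i w), and induction applies to u_i
   w. *)
apply: sign_trans (sign_assoc _ _ _) _.
apply: sign_trans (sign_mul (sign_swap i j) (sign_refl _)) _.
apply: sign_trans (sign_sym (sign_assoc _ _ _)) _.
exact: sign_mul (sign_refl _) (IH us si).
Qed.

Definition nform (x : Z2 n) : umonomial n := word x (enum 'I_n).

Lemma udeg_nform x : udeg (nform x) = x.
Proof.
by apply/rowP => i; rewrite udeg_word_in ?enum_uniq ?mem_enum.
Qed.

Lemma nform0 : nform 0 = '1.
Proof. by rewrite /nform; elim: (enum _) => //= j s ->; rewrite mxE eqxx. Qed.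

(** A product (uv) acts on a normal form as v followed by u, so the claim reduces to single
    generators; x must vary in the induction. *)
Lemma sign_mul_nform u x : u · nform x ~ nform (x + udeg u).
Proof.
case: u => [u|] /=; last by rewrite addr0; exact: sign_refl.
elim: u x => [i|u IHu v IHv] x /=.
  by apply: sign_gen_word; rewrite ?enum_uniq ?mem_enum.
apply: sign_trans (sign_sym (sign_assoc (Some u) (Some v) _)) _.
apply: sign_trans (sign_mul (sign_refl _) (IHv x)) _.
by rewrite (addrC (mon_deg u)) addrA; exact: IHu.
Qed.

Lemma sign_nform u : u ~ nform (udeg u).
Proof.
by rewrite -[u in X in X ~ _]mulg1 -nform0 -[udeg u]add0r; exact: sign_mul_nform.
Qed.

End NormalForm.

(** * Universal property of the quotient by generated relations *)

Lemma na_quot_lift (K : pzRingType) (A B : naAlgType K) (S : A -> Prop)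
    (h : A -> B) :
    linear h -> h '1 = '1 -> {morph h : x y / x · y} ->
    (forall x, S x -> h x = 0) ->
  exists g : na_quot S -> B,
    [/\ linear g, g '1 = '1, {morph g : x y / x · y}
      & forall x, g (na_pi S x) = h x].
Proof.
move=> hL h1 hM hS.
have hD x y : h (x + y) = h x + h y by rewrite -[x]scale1r hL !scale1r.
have h0 : h 0 = 0 by apply: (addrI (h 0)); rewrite -hD !addr0.
have hZ a x : h (a *: x) = a *: h x by rewrite -[a *: x]addr0 hL h0 addr0.
have h_ideal : na_ideal (fun x => h x = 0).
  split=> // [x y hx hy|a x hx|x y hy|x y hx].
  - by rewrite hD hx hy addr0.
  - by rewrite hZ hx scaler0.
  - by rewrite hM hy namul0.
  - by rewrite hM hx na0mul.
(* The kernel of [h] is an ideal containing [S], hence contains the difference between x and the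
   chosen representative of its class. *)
have gE x : h (repr (na_pi S x)) = h x.
  apply: subr0_eq; rewrite -scaleN1r -hZ -hD scaleN1r.
  by have /ideal_predP rx := repr_na_pi S x; exact: (rx _ h_ideal hS).
exists (fun q => h (repr q)); split=> // [a q r||q r].
- have [x <-] := na_pi_surj q; have [y <-] := na_pi_surj r.
  by rewrite -na_piZ -na_piD !gE hL.
- by rewrite -na_pi1 gE.
have [x <-] := na_pi_surj q; have [y <-] := na_pi_surj r.
by rewrite -na_piM !gE hM.
Qed.

(** * Conditions under which a twisted group algebra realises the presentation *)

Section TwistedPresentation.
Variables (K : fieldType) (n p : nat) (anti : bool) (f : twist n).
Variable s : 'I_n -> K.
Local Notation B := (twisted_alg K f).
Local Notation d i := (delta_mx ord0 i : Z2 n).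

Hypothesis s_neq0 : forall i, s i != 0.
Hypothesis f_square : forall i,
  s i ^+ 2 * (-1) ^+ f (d i) (d i) = (-1) ^+ (p <= i)%N.
Hypothesis f_swap : forall i j, i != j -> f (d i) (d j) + f (d j) (d i) = anti%:R.
Hypothesis f_assoc : forall x y z, coboundary f x y z = alt_cubic x y z.

(** The coefficient of the image of u when each u_i is sent to [s i] times e_i; every product
    contributes one twisting sign. *)
Fixpoint mscale (u : monomial n) : K :=
  match u with
  | Gen i => s i
  | Mul v w => mscale v * mscale w * (-1) ^+ f (mon_deg v) (mon_deg w)
  end.

Definition uscale (u : umonomial n) : K := oapp mscale 1 u.

Lemma uscale_neq0 u : uscale u != 0.
Proof.
case: u => [u|] /=; last exact: oner_neq0.
by elim: u => //= v IHv w IHw; rewrite !mulf_neq0 // signr_eq0.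
Qed.

Definition umap (u : umonomial n) : B := uscale u *: tw_basis K f (udeg u).

Lemma umap1 : umap '1 = '1.
Proof. exact: scale1r. Qed.

Lemma umapM : {morph umap : u v / u · v}.
Proof.
have none1 : None = '1 :> umonomial n by [].
case=> [u|] v; last by rewrite none1 mul1g umap1 mul1g.
case: v => [v|]; last by rewrite none1 mulg1 umap1 mulg1.
by rewrite /umap namulZl namulZr tw_mul_basis !scalerA.
Qed.

Lemma umap_square i :
  umap (Some (Gen i)) · umap (Some (Gen i)) = (-1) ^+ (p <= i)%N *: '1.
Proof.
rewrite /umap /= namulZl namulZr tw_mul_basis !scalerA -expr2 f_square.
congr (_ *: tw_basis K f _).
by apply/rowP => k; rewrite !mxE F2_addrr.
Qed.

Lemma umap_swap i j : i != j ->
  umap (Some (Gen i)) · umap (Some (Gen j)) =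
  (-1) ^+ anti *: (umap (Some (Gen j)) · umap (Some (Gen i))).
Proof.
move=> nij; rewrite /umap /= !namulZl !namulZr !tw_mul_basis !scalerA.
rewrite (addrC (d j)); congr (_ *: _).
have -> : f (d i) (d j) = anti%:R + f (d j) (d i).
  by rewrite -(f_swap nij) -addrA F2_addrr addr0.
by rewrite signr_F2D signr_F2b; ring.
Qed.

(** The two bracketings differ by the sign of the coboundary, which on degrees is [phi]. *)
Lemma umap_assoc u v w :
  umap (Some u) · (umap (Some v) · umap (Some w)) =
  (-1) ^+ phi u v w *: (umap (Some u) · umap (Some v) · umap (Some w)).
Proof.
rewrite /umap /= !(namulZl, namulZr, tw_mul_basis, scalerA) addrA.
congr (_ *: _); rewrite -alt_cubic_phi -f_assoc /coboundary !signr_F2D.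
set a := (-1) ^+ _; set b := (-1) ^+ _; set c := (-1) ^+ _; set e := (-1) ^+ _.
have cc : c * c = 1 by rewrite -expr2 sqrr_sign.
have ee : e * e = 1 by rewrite -expr2 sqrr_sign.
(* The signs [c] and [e] of the left bracketing occur twice on the right-hand side; inserting their
   squares on the left makes both sides the same polynomial. *)
by rewrite -[LHS]mulr1 -[X in _ * X]mulr1 -{1}cc -ee; ring.
Qed.

Lemma umap_relator (h : free_alg K n -> B) :
    {morph h : x y / x - y} -> (forall a, {morph h : x / a *: x}) ->
    {morph h : x y / x · y} -> h '1 = '1 ->
    (forall u, h (mon K u) = umap (Some u)) ->
  forall x, relator p anti x -> h x = 0.
Proof.
move=> hB hZ hM h1 hU x.
have E2 (u v : monomial n) :
    h (mon K u · mon K v) = umap (Some u) · umap (Some v).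
  exact: etrans (hM _ _) (congr2 _ (hU u) (hU v)).
have sub0 y z a y' z' :
    h y = y' -> h z = z' -> y' = a *: z' -> h (y - a *: z) = 0.
  by rewrite hB hZ => -> -> ->; rewrite subrr.
case=> [i|i j nij|u v w].
- exact: (sub0 _ _ _ _ _ (E2 _ _) h1 (umap_square i)).
- exact: (sub0 _ _ _ _ _ (E2 _ _) (E2 _ _) (umap_swap nij)).
apply: (sub0 _ _ _ _ _ _ _ (umap_assoc u v w)).
  by apply: etrans (hM _ _) _; rewrite E2 hU.
by apply: etrans (hM _ _) _; rewrite E2 hU.
Qed.

(** * Bijectivity of the induced morphism *)

Section Isomorphism.
Variables (Q : naAlgType K) (h : free_alg K n -> Q) (g : Q -> B).
Hypothesis hD : {morph h : x y / x + y}.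
Hypothesis hB : {morph h : x y / x - y}.
Hypothesis hZ : forall a, {morph h : x / a *: x}.
Hypothesis hM : {morph h : x y / x · y}.
Hypothesis h_surj : forall q, exists x, h x = q.
Hypothesis h_relator : forall x, relator p anti x -> h x = 0.
Hypothesis gL : linear g.
Hypothesis g1 : g '1 = '1.
Hypothesis gM : {morph g : x y / x · y}.
Hypothesis gU : forall u, g (h << u >>) = umap u.

(** The inverse of [g]: since [g] sends the class of [nform x] to [uscale (nform x)] times the basis
    vector at x, that scalar is divided out. *)
Definition basis_preimage (b : B) : Q :=
  \sum_x (b x / uscale (nform x)) *: hmon h (nform x).

Lemma basis_preimageD a b :
  basis_preimage (a + b) = basis_preimage a + basis_preimage b.
Proof.
rewrite -big_split; apply: eq_bigr => x _.
by rewrite ffunE mulrDl scalerDl.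
Qed.

Lemma basis_preimageZ k b : basis_preimage (k *: b) = k *: basis_preimage b.
Proof.
rewrite scaler_sumr; apply: eq_bigr => x _.
by rewrite ffunE scalerA mulrA.
Qed.

Lemma basis_preimage_basis x :
  basis_preimage (tw_basis K f x) = (uscale (nform x))^-1 *: hmon h (nform x).
Proof.
rewrite /basis_preimage (bigD1 x) //= big1 => [|y /negPf nyx].
  by rewrite ffunE eqxx addr0 mul1r.
by rewrite ffunE nyx mul0r scale0r.
Qed.

Lemma gD x y : g (x + y) = g x + g y.
Proof. by rewrite -[x]scale1r gL !scale1r. Qed.

Lemma g0 : g 0 = 0.
Proof. by apply: (addrI (g 0)); rewrite -gD !addr0. Qed.

Lemma gZ a x : g (a *: x) = a *: g x.
Proof. by rewrite -[a *: x]addr0 gL g0 addr0. Qed.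

Lemma basis_preimageK : cancel basis_preimage g.
Proof.
move=> b; rewrite /basis_preimage (big_morph g gD g0) [RHS]tw_basisE.
apply: eq_bigr => x _; rewrite gZ gU /umap udeg_nform scalerA.
by rewrite divfK ?uscale_neq0.
Qed.

(** Up to a sign, which passes through both linear maps, u may be replaced by its normal form, where
    the scalars cancel. *)
Lemma basis_preimage_hmon u : basis_preimage (g (hmon h u)) = hmon h u.
Proof.
have [k ->] := sign_nform hB hZ hM h_relator u.
rewrite gZ basis_preimageZ gU /umap basis_preimageZ basis_preimage_basis.
rewrite udeg_nform; congr (_ *: _).
by rewrite scalerA mulfV ?uscale_neq0 // scale1r.
Qed.

Lemma gK : cancel g basis_preimage.
Proof.
move=> q; have [x <-] := h_surj q.
elim/magma_alg_ind: x => [|x y IHx IHy|a x IH|u].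
- have h0 : h 0 = 0 by apply: (addrI (h 0)); rewrite -hD !addr0.
  by rewrite h0 g0 -[0 in LHS](scale0r (0 : B)) basis_preimageZ scale0r.
- by rewrite hD gD basis_preimageD IHx IHy.
- by rewrite hZ gZ basis_preimageZ IH.
exact: basis_preimage_hmon.
Qed.

Lemma quotient_isomorphic : Q ≅ B.
Proof.
exists g; split=> //.
by exists basis_preimage; [exact: gK | exact: basis_preimageK].
Qed.

End Isomorphism.

Lemma presented_alg_isomorphic : presented_alg K n p anti ≅ B.
Proof.
pose l := @magma_lift K (umonomial n) B umap : free_alg K n -> B.
have l1 : l '1 = '1 by rewrite /l magma_liftU umap1.
have lL : linear l by move=> a x y; rewrite /l magma_liftD magma_liftZ.
have lM : {morph l : x y / x · y} by exact: magma_liftM umapM.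
have lR : forall x, relator p anti x -> l x = 0.
  apply: umap_relator => //; [exact: magma_liftB | exact: magma_liftZ |].
  by move=> u; exact: magma_liftU.
have [g [gL g1 gM gE]] := na_quot_lift lL l1 lM lR.
apply: (@quotient_isomorphic (na_quot (@relator K n p anti)) (na_pi _) g) => //.
- exact: na_piD.
- exact: na_piB.
- exact: na_piZ.
- exact: na_piM.
- exact: na_pi_surj.
- move=> x rx; have /(na_piP (relator p anti) x 0) :
      x - 0 \in ideal_pred (relator p anti).
    by rewrite subr0; apply/ideal_predP; exact: ideal_gen_sub.
  by move=> ->; rewrite -[0 in LHS](scale0r 0) na_piZ scale0r.
by move=> u; rewrite gE; exact: magma_liftU.
Qed.

End TwistedPresentation.

(** * Values of the twisting functions on standard basis vectors *)

Section CubicOnBasis.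
Variable n : nat.
Local Notation d i := (delta_mx ord0 i : Z2 n).
Implicit Types (i j : 'I_n) (x y z : Z2 n).

Lemma delta_rV_mul i j k : j != k -> d i ord0 j * d i ord0 k = 0.
Proof.
move=> njk; rewrite !delta_rVE; have [ji|] := eqVneq j i; last by rewrite mul0r.
by rewrite -ji (eq_sym k) (negPf njk) mulr0.
Qed.

(** Every term contains two coordinates of [d i] at different positions, one of which vanishes. *)
Lemma f_M_delta i y : f_M (d i) y = 0.
Proof.
rewrite /f_M big1 // => a _; rewrite big1 // => b _; rewrite big1 // => c.
move=> /andP[ab bc]; have ac := ltn_trans ab bc.
have E (u v : 'I_n) : (u < v)%N -> d i ord0 u * d i ord0 v = 0.
  by move=> uv; rewrite delta_rV_mul // neq_ltn uv.
by rewrite E // mul0r add0r mulrAC E // mul0r add0r -mulrA E // mulr0.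
Qed.

Lemma sum_pairs_delta (P : rel 'I_n) i j :
  \sum_a \sum_(b | P a b) d i ord0 a * d j ord0 b = (P i j)%:R.
Proof.
rewrite (bigD1 i) //= [X in _ + X]big1 => [|a /negPf nai]; last first.
  by rewrite big1 // => b _; rewrite delta_rVE nai mul0r.
rewrite addr0 big_mkcond (bigD1 j) //= big1 => [|b /negPf nbj].
  by rewrite !delta_rVE !eqxx mulr1 addr0; case: (P i j).
by rewrite (delta_rVE j) nbj mulr0 if_same.
Qed.

Lemma sum_diag_delta (P : pred 'I_n) i j :
  \sum_(a | P a) d i ord0 a * d j ord0 a = (P i && (i == j))%:R.
Proof.
rewrite big_mkcond (bigD1 i) //= big1 => [|a /negPf nai].
  by rewrite !delta_rVE !eqxx mul1r addr0; case: (P i).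
by rewrite delta_rVE nai mul0r if_same.
Qed.

Lemma f_O_delta i j : f_O (d i) (d j) = (i <= j)%N%:R.
Proof.
by rewrite /f_O f_M_delta add0r (sum_pairs_delta (fun a b => (a <= b)%N)).
Qed.

Lemma f_Opq_delta p i j :
  f_Opq p (d i) (d j) = (i <= j)%N%:R + ((i < p)%N && (i == j))%:R.
Proof. by rewrite /f_Opq f_O_delta (sum_diag_delta (fun a => (a < p)%N)). Qed.

Lemma f_Mpq_delta p i j : f_Mpq p (d i) (d j) = ((p <= i)%N && (i == j))%:R.
Proof.
by rewrite /f_Mpq f_M_delta add0r (sum_diag_delta (fun a => (p <= a)%N)).
Qed.

Lemma coboundary_f_O x y z : coboundary (@f_O n) x y z = alt_cubic x y z.
Proof.
apply: etrans (coboundaryD (@f_M n) _ x y z) _.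
by rewrite coboundary_sum_pairs addr0 coboundary_f_M.
Qed.

Lemma coboundary_f_Opq p x y z : coboundary (@f_Opq n p) x y z = alt_cubic x y z.
Proof.
apply: etrans (coboundaryD (@f_O n) _ x y z) _.
by rewrite coboundary_sum_diag addr0 coboundary_f_O.
Qed.

Lemma coboundary_f_Mpq p x y z : coboundary (@f_Mpq n p) x y z = alt_cubic x y z.
Proof.
apply: etrans (coboundaryD (@f_M n) _ x y z) _.
by rewrite coboundary_sum_diag addr0 coboundary_f_M.
Qed.

(** This is the exponent of the sign by which distinct e_i and e_j anticommute in the O algebras. *)
Lemma leq_swapF2 i j : i != j -> (i <= j)%N%:R + (j <= i)%N%:R = 1 :> 'F_2.
Proof.
by case: (ltngtP i j) => [||/ord_inj ->]; rewrite ?addr0 ?add0r ?eqxx.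
Qed.

End CubicOnBasis.

(** * Choice of the rescaling factors in the four cases *)

Theorem proposition4p5 (R : realType) (n p q : nat)
    (n_ge3 : (3 <= n)%N) (pq_n : (p + q = n)%N) :
  (anticommuting_alg R[i] n p ≅ O_alg R[i] n /\
   anticommuting_alg R n p ≅ Opq_alg R n p) /\
  (commuting_alg R[i] n p ≅ M_alg R[i] n /\
   commuting_alg R n p ≅ Mpq_alg R n p).
Proof.
split; split.
(* In O_n every e_i squares to -1, so exactly those with i < p are multiplied by the imaginary
   unit. *)
- apply: (presented_alg_isomorphic (s := fun i => if (i < p)%N then 'i else 1)).
  + by move=> i; case: ifP => _; [exact: neq0Ci | exact: oner_neq0].
  + move=> i; rewrite [twist_fun _ _ _]f_O_delta leqnn signr_F2b.
    by case: ltnP => _; rewrite ?sqrCi ?expr1n ?mul1r // expr1 mulrNN mulr1.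
  + by move=> i j nij; rewrite ![twist_fun _ _ _]f_O_delta leq_swapF2.
  + exact: coboundary_f_O.
(* The diagonal term of [f_Opq] already gives the prescribed squares over the reals. *)
- apply: (presented_alg_isomorphic (s := fun=> 1)).
  + by move=> i; exact: oner_neq0.
  + move=> i; rewrite [twist_fun _ _ _]f_Opq_delta leqnn eqxx andbT.
    rewrite expr1n mul1r signr_F2D !signr_F2b.
    by case: ltnP; rewrite ?expr1 ?mulrNN ?mulr1.
  + move=> i j nij; rewrite ![twist_fun _ _ _]f_Opq_delta.
    by rewrite (eq_sym j) (negPf nij) !andbF !addr0 leq_swapF2.
  + exact: coboundary_f_Opq.
(* In M_n every e_i squares to 1, so now those with i >= p are multiplied by the imaginary unit. *)
- apply: (presented_alg_isomorphic (s := fun i => if (i < p)%N then 1 else 'i)).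
  + by move=> i; case: ifP => _; [exact: oner_neq0 | exact: neq0Ci].
  + move=> i; rewrite [twist_fun _ _ _]f_M_delta mulr1.
    by case: ltnP => _; rewrite /= ?sqrCi ?expr1n.
  + by move=> i j nij; rewrite ![twist_fun _ _ _]f_M_delta addr0.
  + exact: coboundary_f_M.
apply: (presented_alg_isomorphic (s := fun=> 1)).
- by move=> i; exact: oner_neq0.
- move=> i; rewrite [twist_fun _ _ _]f_Mpq_delta eqxx andbT.
  by rewrite expr1n mul1r signr_F2b.
- move=> i j nij; rewrite ![twist_fun _ _ _]f_Mpq_delta.
  by rewrite (eq_sym j) (negPf nij) !andbF addr0.
exact: coboundary_f_Mpq.
Qed.
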